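(* For all integers $n\ge 1$ and $0\le f<n/3$ and every value set $V$, there is an unauthenticated deterministic algorithm in the synchronous sleeping model on $n$ processors that solves Byzantine Agreement over $V$ in the presence of at most $f$ Byzantine processors, with round complexity $O(f)$ and awake complexity $O(\log f)$.
   Context: Model. There is a set of $n$ processors with unique known IDs in $\{1,\dots,n\}$, connected as a clique; $n$ and $f$ are known to all. Computation proceeds in synchronous rounds; in each round every processor sends some (or no) messages, then every message sent in the round is received by its destination (which knows the identity of the sender), then every processor performs local computation. Sleeping model. In any round $t$ a processor may decide to sleep in rounds $t+1,\dots,t+r$ for any $r$ of its choice, and wake up in round $t+r+1$. While sleeping it neither sends nor receives messages, and messages sent to it in those rounds are permanently lost. The round complexity is the worst-case number of rounds until all honest processors have terminated. The awake complexity is the maximum number of rounds any single (honest) processor spends awake, over all executions. Byzantine faults. A worst-case adversary may make up to $f$ processors Byzantine, at any time; it then controls everything they do, including which messages they send or drop and the content of those messages. The other processors are honest (non-faulty) and follow the algorithm. An algorithm is unauthenticated if it does not assume or use digital signatures. Byzantine Agreement. Every processor $p$ has an input in $V$ and must return an output in $V$ such that: (Safety) if a non-faulty processor outputs $v$, then every non-faulty processor outputs $v$; (Validity) if all the non-faulty processors have the same input $v$, then every non-faulty processor outputs $v$; (Termination) every non-faulty processor outputs a value after a finite number of rounds. The $O(\cdot)$ bounds are asymptotic as $f$ grows, with absolute constants independent of $n$, $f$ and $V$. *)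

(* Defs.v *)
From mathcomp Require Import all_boot.

Set Implicit Arguments.
Unset Strict Implicit.
Unset Printing Implicit Defensive.

(* Outcome of the local computation that ends a round: [Continue s r] moves to
   state [s] and sleeps during the next [r] rounds ([r = 0] means awake in the
   very next round); [Return v] outputs [v] and terminates. *)
Variant action (S V : Type) : Type :=
  | Continue (s : S) (r : nat)
  | Return (v : V).

Arguments Continue {S V} s r.
Arguments Return {S V} v.

(* A deterministic algorithm for [n] processors with input and output values
   in [V].  The first argument of [init], [send] and [step] is the identity of
   the processor running the code.  [send i s j] is the message, if any, from
   [i] to [j]; the inbox given to [step] is indexed by the sender, which the
   receiver thus knows.  Messages carry no signatures: see [forge] below. *)
Record algorithm (n : nat) (V : Type) : Type := Algorithm {
  state : Type;
  msg : Type;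
  init : 'I_n -> V -> state;
  send : 'I_n -> state -> 'I_n -> option msg;
  step : 'I_n -> state -> ('I_n -> option msg) -> action state V
}.

(* Rounds are numbered from 0.  [byz t] is the set of processors that are
   Byzantine in round [t]; it only grows.  [forge t i j] is what [i] sends to
   [j] in round [t] if [i] is then Byzantine, with no restriction on its
   content.  As the algorithm is deterministic, quantifying over all such
   sequences covers every adaptive, full-information adversary. *)
Record adversary (n : nat) (M : Type) : Type := Adversary {
  byz : nat -> {set 'I_n};
  forge : nat -> 'I_n -> 'I_n -> option M;
  byz_mono : forall t, byz t \subset byz t.+1
}.

Definition bounded_by (n : nat) (M : Type) (f : nat) (B : adversary n M) : Prop :=
  forall t, #|byz B t| <= f.

Definition honest (n : nat) (M : Type) (B : adversary n M) (i : 'I_n) : Prop :=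
  forall t, i \notin byz B t.

(* [Running s k]: not terminated, in state [s], with [k] rounds of sleep left
   before the next awake round. *)
Variant status (S V : Type) : Type :=
  | Running (s : S) (k : nat)
  | Returned (v : V).

Arguments Running {S V} s k.
Arguments Returned {S V} v.

Section Execution.

Variables (n : nat) (V : Type) (A : algorithm n V).
Variables (x : 'I_n -> V) (B : adversary n (msg A)).

Definition is_awake (st : status (state A) V) : bool :=
  if st is Running _ 0 then true else false.

(* The message sent by [i] to [j] in round [t], when [c] is the configuration
   at the beginning of the round. *)
Definition sent (c : 'I_n -> status (state A) V) (t : nat) (i j : 'I_n) :
    option (msg A) :=
  if i \in byz B t then forge B t i j
  else if c i is Running s 0 then send i s j
  else None.

(* A message to a processor that sleeps or has terminated is lost: only the
   [Running s 0] case reads the messages of the round. *)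
Definition next_status (c : 'I_n -> status (state A) V) (t : nat) (i : 'I_n) :
    status (state A) V :=
  match c i with
  | Running s 0 =>
      match step i s (fun j => sent c t j i) with
      | Continue s' r => Running s' r
      | Return v => Returned v
      end
  | Running s k.+1 => Running s k
  | Returned v => Returned v
  end.

(* The configuration at the beginning of round [t]; every processor is awake
   in round 0.  The entries of Byzantine processors are meaningless and have no
   influence on the others, since [sent] ignores them. *)
Fixpoint config (t : nat) : 'I_n -> status (state A) V :=
  match t with
  | 0 => fun i => Running (init A i (x i)) 0
  | t'.+1 => next_status (config t') t'
  end.

Definition outputs (i : 'I_n) (v : V) : Prop :=
  exists t, config t i = Returned v.

Definition terminated_by (T : nat) (i : 'I_n) : Prop :=
  exists v, config T i = Returned v.

(* The number of the first [T] rounds in which [i] is awake. *)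
Definition awake_rounds (T : nat) (i : 'I_n) : nat :=
  \sum_(t < T) is_awake (config t i).

Definition safety : Prop :=
  forall i v, honest B i -> outputs i v ->
  forall j, honest B j -> outputs j v.

Definition validity : Prop :=
  forall v, (forall i, honest B i -> x i = v) ->
  forall j, honest B j -> outputs j v.

Definition termination : Prop :=
  forall i, honest B i -> exists v, outputs i v.

End Execution.

Definition solves_BA (n : nat) (V : Type) (A : algorithm n V) (f : nat) : Prop :=
  forall (x : 'I_n -> V) (B : adversary n (msg A)), bounded_by f B ->
  [/\ safety x B, validity x B & termination x B].

Definition round_complexity_le (n : nat) (V : Type) (A : algorithm n V)
    (f T : nat) : Prop :=
  forall (x : 'I_n -> V) (B : adversary n (msg A)), bounded_by f B ->
  forall i, honest B i -> terminated_by x B T i.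

Definition awake_complexity_le (n : nat) (V : Type) (A : algorithm n V)
    (f a : nat) : Prop :=
  forall (x : 'I_n -> V) (B : adversary n (msg A)), bounded_by f B ->
  forall i, honest B i -> forall T, awake_rounds x B T i <= a.

(* Main.v *)
(** Recursive phase king.  A committee alternates two-round graded consensus
    with a proposal made by each of its two halves in turn, the half computing
    its proposal by running the protocol recursively.  If fewer than a third of
    the committee is faulty, the same holds of one of the halves; that half
    brings about agreement, and graded consensus protects an existing agreement
    from the proposal of the other half.  While a half is computing, the rest of
    the committee sleeps, so each level of the recursion costs every processor
    O(1) awake rounds, whereas the round complexity satisfies
    T(m) = 2 T(m/2) + O(1) = O(m).  It then suffices to let 3f+1 processors
    agree and announce the result to the others. *)

Require Import Defs.
From mathcomp Require Import all_boot.
From mathcomp Require Import zify boolp.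

Set Implicit Arguments.
Unset Strict Implicit.
Unset Printing Implicit Defensive.

(** * Vote counting in a committee with faulty members *)

Section Votes.

Variables (I : finType) (V : Type).
Implicit Types (C F : {set I}) (ib : I -> option V) (w : V).

Definition tally C ib w := #|[set j in C | `[< ib j = Some w >]]|.

(** The search runs over voters, as [V] need not be finite; if several values reach the quorum, any
    one of them may result. *)
Definition winner C q ib : option V :=
  obind ib [pick j in C | if ib j is Some w then q <= tally C ib w else false].

Definition good C F := 3 * #|C :&: F| < #|C|.

(** For nonempty [C], the largest number of faulty members that [good] allows. *)
Definition tolerance C := #|C|.-1 %/ 3.

Lemma good_tolerance C F :
  good C F -> #|C :&: F| <= tolerance C /\ 3 * tolerance C < #|C|.
Proof. rewrite /good /tolerance; lia. Qed.

Lemma card_honest C F : #|C :\: F| = #|C| - #|C :&: F|.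
Proof. by rewrite cardsD. Qed.

Lemma winner_tally C q ib w : winner C q ib = Some w -> q <= tally C ib w.
Proof.
rewrite /winner; case: pickP => //= j /andP[_].
by case E: (ib j) => [w'|//] q_le [<-].
Qed.

Lemma winner_ex C q ib w :
  0 < q -> q <= tally C ib w -> exists w', winner C q ib = Some w'.
Proof.
move=> q_gt0 q_le; rewrite /winner; case: pickP => [j /= /andP[_]|no].
  by case: (ib j) => // w' _; exists w'.
have /card_gt0P[j] : 0 < tally C ib w by lia.
by rewrite inE => /andP[jC /asboolP Ej]; have := no j; rewrite jC Ej q_le.
Qed.

Lemma tally_honest C F ib w q : #|C :&: F| < q -> q <= tally C ib w ->
  exists2 j, j \in C :\: F & ib j = Some w.
Proof.
move=> lt_q le_q; have lt_t := leq_trans lt_q le_q.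
case: (pickP (mem ([set j in C | `[< ib j = Some w >]] :\: F))) => [j|no].
  rewrite !inE => /and3P[jF jC /asboolP Ej]; exists j => //.
  by rewrite !inE jF.
have /subset_leq_card : [set j in C | `[< ib j = Some w >]] \subset C :&: F.
  apply/subsetP=> j jS; have := no j; rewrite /= inE jS andbT => /negbFE jF.
  by move: jS; rewrite !inE jF andbT => /andP[].
by rewrite leqNgt lt_t.
Qed.

(** Two receivers can get different votes only from faulty members. *)
Lemma tally_transfer C F ib ib' w : {in C :\: F, ib =1 ib'} ->
  tally C ib w <= tally C ib' w + #|C :&: F|.
Proof.
move=> eq_ib; rewrite /tally -cardsUI; apply: leq_trans (leq_addr _ _).
apply/subset_leq_card/subsetP=> j; rewrite !inE => /andP[jC Ej]; rewrite jC /=.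
case: (boolP (j \in F)) => jF; first by rewrite orbT.
by rewrite orbF -eq_ib // inE jF.
Qed.

Lemma tally_disjoint C ib w w' :
  w <> w' -> tally C ib w + tally C ib w' <= #|C|.
Proof.
move=> ne; rewrite /tally -cardsUI addnC.
set X := _ :&: _; have ->: X = set0.
  apply/setP=> j; rewrite !inE; apply/negP=> /andP[/andP[_ /asboolP ->]].
  by case/andP=> _ /asboolP[].
rewrite cards0; apply/subset_leq_card/subsetP=> j.
by rewrite !inE => /orP[] /andP[].
Qed.

Lemma winner_unanimous C F q ib w : #|C :&: F| < q -> q <= #|C :\: F| ->
  {in C :\: F, forall j, ib j = Some w} -> winner C q ib = Some w.
Proof.
move=> lt_q le_q Ew.
have le_t : q <= tally C ib w.
  apply/(leq_trans le_q)/subset_leq_card/subsetP=> j jH; rewrite inE.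
  by case/setDP: (jH) => -> _; apply/asboolP/Ew.
have [w' Ew'] := winner_ex (leq_ltn_trans (leq0n _) lt_q) le_t.
have [j jH] := tally_honest lt_q (winner_tally Ew').
by rewrite Ew // Ew' => -[->].
Qed.

(* Two quorums of [#|C| - tolerance C] votes for different values would, once
   the faulty double votes are discounted, need more than [#|C|] voters. *)
Lemma quorum_unique C F ib ib' w w' : good C F -> {in C :\: F, ib =1 ib'} ->
  winner C (#|C| - tolerance C) ib = Some w ->
  winner C (#|C| - tolerance C) ib' = Some w' -> w = w'.
Proof.
move=> /good_tolerance[le_t t_lt] eq_ib /winner_tally q_w /winner_tally q_w'.
case: (pselect (w = w')) => // ne.
have := tally_disjoint C ib' ne; have := tally_transfer w eq_ib; lia.
Qed.

End Votes.

(** * Programs made of broadcasts and sleep *)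

(* A program of a processor that broadcasts at most one value per round.  [Idle]
   is a round of sleep, so that programs run by different processors can be
   aligned in time. *)
Inductive prog (n : nat) (V : Type) : Type :=
  | Ret (v : V)
  | Idle (p : prog n V)
  | Round (m : option V) (k : ('I_n -> option V) -> prog n V).

Arguments Ret {n V} v.
Arguments Idle {n V} p.
Arguments Round {n V} m k.

Definition advance n V (p : prog n V) (ib : 'I_n -> option V) : prog n V :=
  match p with
  | Ret _ => p
  | Idle q => q
  | Round _ k => k ib
  end.

Definition is_round n V (p : prog n V) : bool :=
  if p is Round _ _ then true else false.

Fixpoint rounds_le n V (p : prog n V) (w : nat) : Prop :=
  match p, w with
  | Ret _, _ => True
  | Idle q, _ => rounds_le q w
  | Round _ _, 0 => False
  | Round _ k, w'.+1 => forall ib, rounds_le (k ib) w'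
  end.

(** * The protocol and its cost *)

Section Protocol.

Variables (n : nat) (V : Type).
Implicit Types (C A : {set 'I_n}) (i : 'I_n) (v : V).

Local Notation prog := (prog n V).

(** With t = [tolerance C], a value backed by |C| - t votes is proposed in the second round. Then
    |C| - t proposals give grade [true], while t + 1, enough to include an honest one, already fix
    the value. *)
Definition graded C v (K : V -> bool -> prog) : prog :=
  Round (Some v) (fun ib =>
  Round (winner C (#|C| - tolerance C) ib) (fun ib' =>
  K (odflt v (winner C (tolerance C).+1 ib'))
    (isSome (winner C (#|C| - tolerance C) ib')))).

Definition announce A v v' (K : V -> prog) : prog :=
  Round (Some v) (fun ib => K (odflt v' (winner A (tolerance A).+1 ib))).

(* [R] is the protocol by which [A] computes its proposal, in [T] rounds. *)
Definition phase (R : {set 'I_n} -> V -> (V -> prog) -> prog) (T : nat)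
    C A i v (K : V -> prog) : prog :=
  graded C v (fun v' g =>
    let propose a := announce A a v' (fun r => K (if g then v' else r)) in
    if i \in A then R A v' propose else iter T Idle (propose v')).

Definition lower C : {set 'I_n} := [set i in take (#|C|./2) (enum C)].
Definition upper C := C :\: lower C.

(** It depends on the depth and not on the size, so both halves take equally long. The 3 counts two
    rounds of [graded] and one of [announce]. *)
Fixpoint duration (d : nat) : nat :=
  if d is e.+1 then 2 * (duration e + 3) else 0.

Fixpoint agree (d : nat) i C v (K : V -> prog) : prog :=
  if d is e.+1 then
    phase (agree e i) (duration e) C (lower C) i v (fun v' =>
    phase (agree e i) (duration e) C (upper C) i v' K)
  else K v.

Lemma durationE d : duration d + 6 = 6 * 2 ^ d.
Proof. by elim: d => //= d IH; rewrite expnS; lia. Qed.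

Lemma sub_lower C : lower C \subset C.
Proof. by apply/subsetP=> i; rewrite inE => /mem_take; rewrite mem_enum. Qed.

Lemma card_lower C : #|lower C| = #|C|./2.
Proof.
rewrite cardsE (card_uniqP _) ?take_uniq ?enum_uniq //.
by rewrite size_takel // -cardE; lia.
Qed.

Lemma card_upper C : #|upper C| = uphalf #|C|.
Proof.
rewrite cardsD (setIidPr (sub_lower C)) card_lower.
by have := uphalf_half #|C|; have := odd_double_half #|C|; lia.
Qed.

(** If each half were at least one third faulty, so would be their disjoint union [C]. *)
Lemma good_half C F : good C F -> good (lower C) F \/ good (upper C) F.
Proof.
rewrite /good => gC; apply/orP; apply: contraLR gC.
rewrite negb_or -!leqNgt => /andP[gL gU].
have := cardsID (lower C) C; rewrite (setIidPr (sub_lower C)).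
have := cardsID (lower C) (C :&: F).
have -> : C :&: F :&: lower C = lower C :&: F.
  by rewrite setIAC (setIidPr (sub_lower C)).
have -> : (C :&: F) :\: lower C = upper C :&: F.
  by rewrite /upper setIDAC.
by rewrite -/(upper C); lia.
Qed.

Lemma rounds_le_mono (p : prog) w w' :
  w <= w' -> rounds_le p w -> rounds_le p w'.
Proof.
elim: p w w' => [v|q IH|m k IH] [|w] [|w'] //= le_w; try exact: IH.
by move=> rk ib; apply: IH (rk ib).
Qed.

Lemma idle_rounds T (p : prog) w :
  rounds_le p w -> rounds_le (iter T Idle p) w.
Proof. by elim: T. Qed.

Lemma phase_rounds R T C A i v K c w :
  (forall v' K' w', (forall u, rounds_le (K' u) w') ->
     rounds_le (R A v' K') (c + w')) ->
  (forall u, rounds_le (K u) w) ->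
  rounds_le (phase R T C A i v K) ((if i \in A then c else 0) + w.+3).
Proof.
move=> rR rK; rewrite !addnS => ib ib'; rewrite -addnS.
case: ifP => _; first by apply: rR => u ib2; apply: rK.
by apply: idle_rounds => ib2; apply: rK.
Qed.

(** The halves are disjoint, so a processor takes part in at most one of the two recursive calls;
    each level adds two phases of 3 awake rounds. *)
Lemma agree_rounds d i C v K w :
  (forall u, rounds_le (K u) w) -> rounds_le (agree d i C v K) (6 * d + w).
Proof.
elim: d C v K w => [|d IH] C v K w rK; first exact: rK.
have le_w : (if i \in lower C then 6 * d else 0) +
    ((if i \in upper C then 6 * d else 0) + w.+3).+3 <= 6 * d.+1 + w.
  by rewrite in_setD; case: (i \in lower C) => /=; [|case: ifP => _]; lia.
apply: (rounds_le_mono le_w); apply: phase_rounds => [*|u]; first exact: IH.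
by apply: phase_rounds => // *; apply: IH.
Qed.

End Protocol.

(** * Correctness against a static set of faulty processors *)

Section Trace.

Variables (n : nat) (V : Type) (F : {set 'I_n}).
Variables (cur : nat -> 'I_n -> prog n V).
Variables (inbox : nat -> 'I_n -> 'I_n -> option V).
Hypothesis curS : forall t i, cur t.+1 i = advance (cur t i) (inbox t i).
Hypothesis inboxE : forall t i j m k,
  j \notin F -> cur t j = Round m k -> inbox t i j = m.
Implicit Types (C A : {set 'I_n}) (v : 'I_n -> V) (K : 'I_n -> V -> prog n V).

Lemma cur_idle t i T p : cur t i = iter T Idle p -> cur (t + T) i = p.
Proof.
elim: T t => [|T IH] t E; first by rewrite addn0.
by rewrite addnS -addSn; apply: IH; rewrite curS E.
Qed.

(* Even if [C] is not good, in which case the outputs [u] may be arbitrary, they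
   are produced after exactly [T] rounds. *)
Definition achieves (R : 'I_n -> {set 'I_n} -> V -> (V -> prog n V) -> prog n V)
    (T : nat) C (agr : Prop) : Prop :=
  forall t v K, {in C :\: F, forall i, cur t i = R i C (v i) (K i)} ->
  exists u, [/\ {in C :\: F, forall i, cur (t + T) i = K i (u i)},
    agr -> exists w, {in C :\: F, forall i, u i = w} &
    good C F -> forall w, {in C :\: F, forall i, v i = w} ->
      {in C :\: F, forall i, u i = w}].

(** By [quorum_unique], all honest proposals carry one value. Grade [true] means |C| - t proposals
    of it, so every receiver gets at least |C| - 2t > t of them, while any other value gets only
    faulty ones, at most t. *)
Lemma graded_spec C t v (K : 'I_n -> V -> bool -> prog n V) :
  {in C :\: F, forall i, cur t i = graded C (v i) (K i)} ->
  exists u g, [/\ {in C :\: F, forall i, cur t.+2 i = K i (u i) (g i)},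
    good C F -> {in C :\: F &, forall i j, g i -> u j = u i} &
    good C F -> forall w, {in C :\: F, forall i, v i = w} ->
      {in C :\: F, forall i, u i = w /\ g i}].
Proof.
move=> cur0.
have votes i : {in C :\: F, forall j, inbox t i j = Some (v j)}.
  by move=> j jH; apply: inboxE (cur0 j jH); case/setDP: jH.
pose p j := winner C (#|C| - tolerance C) (inbox t j).
have cur1 : {in C :\: F, forall i, cur t.+1 i = Round (p i) (fun ib =>
    K i (odflt (v i) (winner C (tolerance C).+1 ib))
      (isSome (winner C (#|C| - tolerance C) ib)))}.
  by move=> i iH; rewrite curS (cur0 i iH).
have props i : {in C :\: F, forall j, inbox t.+1 i j = p j}.
  by move=> j jH; apply: inboxE (cur1 j jH); case/setDP: jH.
exists (fun i => odflt (v i) (winner C (tolerance C).+1 (inbox t.+1 i))).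
exists (fun i => isSome (winner C (#|C| - tolerance C) (inbox t.+1 i))).
split=> [i iH|gC i i' iH i'H|gC w vw].
- by rewrite curS (cur1 i iH).
- have [le_t t_lt] := good_tolerance gC.
  have p_uniq j j' w w' : j \in C :\: F -> j' \in C :\: F ->
      p j = Some w -> p j' = Some w' -> w = w'.
    move=> jH j'H; apply: (quorum_unique gC) => l lH.
    by rewrite !votes.
  case Ei: (winner _ _ _) => [w|//] _.
  have q_w := winner_tally Ei.
  have [|j jH pj] := @tally_honest _ _ _ F _ _ _ _ q_w; first lia.
  rewrite props // in pj.
  suff all_w l : odflt (v l) (winner C (tolerance C).+1 (inbox t.+1 l)) = w.
    by rewrite !all_w.
  have le_w : tolerance C < tally C (inbox t.+1 l) w.
    have eq_ib : {in C :\: F, inbox t.+1 i =1 inbox t.+1 l}.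
      by move=> r rH; rewrite !props.
    by have := tally_transfer w eq_ib; lia.
  have [w' El] := winner_ex (ltn0Sn _) le_w; rewrite El /=.
  have [|j' j'H pj'] := @tally_honest _ _ _ F _ _ _ _ (winner_tally El).
    by lia.
  by rewrite props // in pj'; apply: p_uniq pj' pj.
- have [le_t t_lt] := good_tolerance gC; have cH := card_honest C F.
  have pw : {in C :\: F, forall j, p j = Some w}.
    move=> j jH; apply: (@winner_unanimous _ _ _ F); try lia.
    by move=> l lH; rewrite votes // vw.
  have uw q i : tolerance C < q <= #|C| - tolerance C ->
      winner C q (inbox t.+1 i) = Some w.
    move=> le_q; apply: (@winner_unanimous _ _ _ F); try lia.
    by move=> l lH; rewrite props // pw.
  by move=> i iH; rewrite !uw //; lia.
Qed.

Lemma announce_spec C A t (a v : 'I_n -> V) K : A \subset C ->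
  {in C :\: F, forall i, cur t i = announce A (a i) (v i) (K i)} ->
  exists r, {in C :\: F, forall i, cur t.+1 i = K i (r i)} /\
    (good A F -> forall w, {in A :\: F, forall i, a i = w} -> forall i, r i = w).
Proof.
move=> /subsetP sAC cur0.
have votes i : {in C :\: F, forall j, inbox t i j = Some (a j)}.
  by move=> j jH; apply: inboxE (cur0 j jH); case/setDP: jH.
exists (fun i => odflt (v i) (winner A (tolerance A).+1 (inbox t i))).
split=> [i iH|gA w aw i]; first by rewrite curS (cur0 i iH).
have [le_t t_lt] := good_tolerance gA; have cH := card_honest A F.
rewrite (@winner_unanimous _ _ _ F _ _ w) //; try lia.
move=> j jA; rewrite votes ?aw //.
by move: jA; rewrite !inE => /andP[-> /sAC].
Qed.

(** A common value survives even a bad [A]: every honest grade is then [true], so the proposal is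
    ignored. *)
Lemma phase_spec R T C A : A \subset C -> achieves R T A (good A F) ->
  achieves (fun i C' => phase (R i) T C' A i) (T + 3) C (good C F /\ good A F).
Proof.
move=> sAC specR t v K cur0.
have sAC' i : i \in A :\: F -> i \in C :\: F.
  by rewrite !inE => /andP[-> /(subsetP sAC)].
pose K1 i (v' : V) (g : bool) :=
  let propose (a : V) := announce A a v' (fun r => K i (if g then v' else r)) in
  if i \in A then R i A v' propose else iter T Idle (propose v').
have [v' [g [cur2 gr_agr gr_val]]] := @graded_spec C t v K1 cur0.
pose K2 i (a : V) := announce A a (v' i) (fun r => K i (if g i then v' i else r)).
have [|a [cur3 agrA valA]] := specR t.+2 v' K2.
  by move=> i iA; have /setDP[iA' _] := iA; rewrite cur2 ?sAC' // /K1 iA'.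
pose b i := if i \in A then a i else v' i.
have cur3' : {in C :\: F, forall i, cur (t.+2 + T) i = K2 i (b i)}.
  move=> i iH; rewrite /b; case: ifPn => iA.
    by apply: cur3; case/setDP: iH => _ iF; rewrite inE iF.
  by apply: cur_idle; rewrite cur2 // /K1 (negbTE iA).
have bA : {in A, b =1 a} by move=> i iA; rewrite /b iA.
have [r [cur4 rE]] := @announce_spec C A _ b v'
  (fun i s => K i (if g i then v' i else s)) sAC cur3'.
exists (fun i => if g i then v' i else r i); split=> [i iH|[gC gA]|gC w vw i iH].
- by rewrite -cur4 //; congr cur; lia.
(* A value of grade [true] is held by all honest members of [C], so [A] proposes it by validity. If
   no honest grade is [true], all adopt the proposal on which [A] agrees. *)
- have [[i iH gi]|no] := pselect (exists2 i, i \in C :\: F & g i).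
    have v'E j : j \in C :\: F -> v' j = v' i by move=> jH; apply: gr_agr.
    have rw : forall j, r j = v' i.
      apply: (rE gA) => j jA; have /setDP[jA' _] := jA; rewrite bA //.
      by apply: (valA gA) => // l lA; apply/v'E/sAC'.
    by exists (v' i) => j jH; rewrite rw v'E // if_same.
  have [w aw] := agrA gA; exists w => i iH.
  case: ifP => gi; first by case: no; exists i.
  by apply: (rE gA) => j jA; have /setDP[jA' _] := jA; rewrite bA ?aw.
- by have [-> ->] := gr_val gC w vw i iH.
Qed.

Lemma agree_spec d C :
  #|C| <= 2 ^ d -> achieves (agree d) (duration d) C (good C F).
Proof.
elim: d C => [|d IH] C cardC.
  move=> t v K cur0; exists v; split=> //; first by rewrite addn0.
  move=> gC; have [le_t t_lt] := good_tolerance gC; have cH := card_honest C F.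
  have /cards1P[i Ci] : #|C| == 1 by rewrite expn0 in cardC; rewrite /good in gC; lia.
  by exists (v i) => j /setDP[]; rewrite Ci inE => /eqP->.
rewrite expnS in cardC.
have specL : achieves (agree d) (duration d) (lower C) (good (lower C) F).
  by apply: IH; rewrite card_lower; lia.
have specU : achieves (agree d) (duration d) (upper C) (good (upper C) F).
  by apply: IH; rewrite card_upper; lia.
move=> t v K cur0.
have [v1 [cur1 agr1 val1]] := phase_spec (sub_lower C) specL
  (K := fun i y => phase (agree d i) (duration d) C (upper C) i y (K i)) cur0.
have [u [cur2 agr2 val2]] := phase_spec (subsetDl _ _) specU cur1.
exists u; split=> [i iH|gC|gC w vw].
- by rewrite -cur2 //=; congr cur; lia.
(* If the lower half is good, the first phase brings agreement and the second preserves it;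
   otherwise the second phase brings it from any state. *)
- have [gL|gU] := good_half gC; last exact: agr2.
  by have [w v1w] := agr1 (conj gC gL); exists w; apply: val2.
- by apply: (val2 gC w); apply: val1.
Qed.

End Trace.

(** * Reduction to a static adversary *)

(* This allows to treat a processor corrupted in any round as faulty from the
   start, so that the adversary is in effect static. *)
Lemma eventually_byz n M (f : nat) (B : adversary n M) : bounded_by f B ->
  exists F : {set 'I_n}, #|F| <= f /\ forall i, honest B i <-> i \notin F.
Proof.
move=> Bf; have mono t s : t <= s -> byz B t \subset byz B s.
  move/subnKC <-; elim: (s - t) => [|r IH]; first by rewrite addn0.
  by rewrite addnS; apply: subset_trans IH (byz_mono _ _).
have [T TP] : exists T : 'I_n -> nat, forall i, ~ honest B i -> i \in byz B (T i).
  apply: (@fin_all_exists _ (fun=> nat)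
    (fun i t => ~ honest B i -> i \in byz B t)) => i.
  case: (pselect (honest B i)) => h; first by exists 0.
  by have /existsNP[t /negP/negPn it] := h; exists t.
exists (byz B (\max_i T i)); split=> // i; split=> [h|]; first exact: h.
move=> iF; apply: contrapT => /TP iT; move/negP: iF; apply.
exact: (subsetP (mono _ _ (leq_bigmax i))).
Qed.

(** * Compilation of programs into the sleeping model *)

Section Compilation.

Variables (n : nat) (V : Type) (main : 'I_n -> V -> prog n V).

(** Consecutive [Idle] rounds merge into one sleep, whose length must be chosen when it starts. An
    idle stretch that ends in [Ret] returns at once. *)
Fixpoint settle (p : prog n V) : action (prog n V) V :=
  match p with
  | Ret v => Return v
  | Idle q => if settle q is Continue s r then Continue s r.+1 else settle q
  | Round _ _ => Continue p 0
  end.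

Definition compile : algorithm n V :=
  Algorithm main
    (fun _ p _ => if p is Round m _ then m else None)
    (fun _ p ib => settle (advance p ib)).

Hypothesis main_round : forall i v, is_round (main i v).

Variables (x : 'I_n -> V) (B : adversary n (msg compile)).

Local Notation config := (@config n V compile x B).

(** A view of the run without merged sleep: one constructor is consumed per round, as in [Trace]. *)
Fixpoint residual (t : nat) (i : 'I_n) : prog n V :=
  if t is s.+1 then advance (residual s i) (fun j => sent B (config s) s j i)
  else main i (x i).

Definition status_of (a : action (prog n V) V) : status (prog n V) V :=
  match a with Continue s r => Running s r | Return v => Returned v end.

Lemma config_residual t i : config t i = status_of (settle (residual t i)).
Proof.
elim: t i => [|t IH] i /=.
  by have := main_round i (x i); case: (main i (x i)).
rewrite /next_status IH; case: (residual t i) => [v|q|m k] //=.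
by case: (settle q).
Qed.

Lemma sent_residual t j i m k : honest B j -> residual t j = Round m k ->
  sent B (config t) t j i = m.
Proof.
by move=> hj Ej; rewrite /sent (negbTE (hj t)) config_residual Ej.
Qed.

Lemma awake_residual t i : is_awake (config t i) = is_round (residual t i).
Proof.
rewrite config_residual; case: (residual t i) => //= q.
by case: (settle q).
Qed.

Lemma awake_rounds_residual i w T :
  rounds_le (main i (x i)) w -> awake_rounds x B T i <= w.
Proof.
move=> rw.
have -> : awake_rounds x B T i = \sum_(0 <= t < T) is_round (residual (0 + t) i).
  by rewrite /awake_rounds big_mkord; apply: eq_bigr => t _; rewrite awake_residual.
suff count t : rounds_le (residual t i) w ->
  \sum_(0 <= s < T) is_round (residual (t + s) i) <= w by exact: count.
elim: T t w {rw} => [|T IH] t w rt; first by rewrite big_geq.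
rewrite big_nat_recl // addn0.
have [w' rS le_w] : exists2 w', rounds_le (residual t.+1 i) w' &
    is_round (residual t i) + w' <= w.
  move: rt => /=; case: (residual t i) => [v|q|m k] /=; try by exists w.
  by case: w => // w rk; exists w.
apply: leq_trans le_w; rewrite leq_add2l.
by under eq_bigr do rewrite addnS -addSn; apply: IH.
Qed.

Lemma outputs_residual t i v w :
  residual t i = Ret v -> outputs x B i w -> w = v.
Proof.
move=> Et [s Es].
have persist u r y : config r i = Returned y -> config (r + u) i = Returned y.
  elim: u => [|u IH] Er; first by rewrite addn0.
  by rewrite addnS /= /next_status IH.
have Et' : config t i = Returned v by rewrite config_residual Et.
by have := persist s _ _ Et'; rewrite addnC (persist t _ _ Es) => -[].
Qed.

End Compilation.

(** * The algorithm for all processors *)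

Section Agreement.

Variables (n f : nat) (V : Type).
Hypothesis lt_f : 3 * f < n.

Definition committee : {set 'I_n} := [set i : 'I_n | i < 3 * f + 1].

(** Since f < 2 ^ (trunc_log 2 f + 1), this gives 3f + 1 <= 4 (f + 1) <= 2 ^ depth. *)
Definition depth : nat := trunc_log 2 f + 3.

(* Every processor is awake in round 0, hence the initial silent round. *)
Definition agreement (i : 'I_n) (v : V) : prog n V :=
  Round None (fun _ =>
    let finish u := announce committee u u Ret in
    if i \in committee then agree depth i committee v finish
    else iter (duration depth) Idle (finish v)).

Lemma card_committee : #|committee| = 3 * f + 1.
Proof.
rewrite -sum1_card (eq_bigl (fun i : 'I_n => i < 3 * f + 1)).
  by rewrite -(big_ord_widen n (fun=> 1)) ?sum1_card ?card_ord //; lia.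
by move=> i; rewrite inE.
Qed.

Lemma committee_le : 3 * f + 1 <= 2 ^ depth.
Proof.
have := trunc_log_ltn f (isT : 1 < 2).
by rewrite /depth expnS expnD; lia.
Qed.

Lemma agreement_rounds i v : rounds_le (agreement i v) (6 * depth + 2).
Proof.
rewrite addnS => ib; case: (i \in committee).
  exact: (@agree_rounds n V depth i committee v _ 1).
by apply: idle_rounds; rewrite addn1.
Qed.

Lemma agreement_correct (x : 'I_n -> V) (B : adversary n (msg (compile agreement))) :
  bounded_by f B ->
  exists u : 'I_n -> V, [/\
    forall i, honest B i -> residual x B (duration depth + 2) i = Ret (u i),
    exists w, forall i, honest B i -> u i = w &
    forall w, (forall i, honest B i -> x i = w) -> forall i, honest B i -> u i = w].
Proof.
move=> Bf; have [F [cardF hF]] := eventually_byz Bf.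
pose cur := residual x B.
pose inbox t i j := sent B (config x B t) t j i.
have curS t i : cur t.+1 i = advance (cur t i) (inbox t i) by [].
have inboxE t i j m k : j \notin F -> cur t j = Round m k -> inbox t i j = m.
  by move=> /hF; apply: sent_residual.
have gC : good committee F.
  rewrite /good card_committee.
  by have := subset_leq_card (subsetIr committee F); lia.
pose K (i : 'I_n) u := announce committee u u (@Ret n V).
have cur1 : {in committee :\: F, forall i,
    cur 1 i = agree depth i committee (x i) (K i)}.
  by move=> i /setDP[iC _]; rewrite /cur /= iC.
have [|a [cur2 agrC valC]] := agree_spec curS inboxE _ cur1.
  by rewrite card_committee committee_le.
pose b i := if i \in committee then a i else x i.
(* The final round is an announcement by [committee] to the set of all processors. *)
have cur2' : {in [set: 'I_n] :\: F, forall i,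
    cur (1 + duration depth) i = announce committee (b i) (b i) Ret}.
  move=> i /setDP[_ iF]; rewrite /b; case: ifPn => iC.
    by apply: cur2; rewrite inE iF.
  by apply: (cur_idle curS); rewrite /cur /= (negbTE iC).
have [r [cur3 rE]] := announce_spec curS inboxE (K := fun=> Ret) (subsetT _) cur2'.
have bC w : {in committee :\: F, forall i, a i = w} -> forall i, r i = w.
  by move=> aw; apply: (rE gC) => i iH; have /setDP[iC _] := iH; rewrite /b iC aw.
exists r; split=> [i /hF iF||w xw i hi].
- by rewrite -cur3 ?inE ?iF //; congr residual; lia.
- by have [w aw] := agrC gC; exists w => i _; apply: bC.
- by apply: bC; apply: (valC gC) => j /setDP[_ /hF]; apply: xw.
Qed.

End Agreement.

Theorem mainTheorem3 :
  exists c f0 : nat,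
  forall (n f : nat) (V : Type), 1 <= n -> 3 * f < n ->
  exists A : algorithm n V,
    solves_BA A f /\
    (f0 <= f ->
       round_complexity_le A f (c * f) /\
       awake_complexity_le A f (c * trunc_log 2 f)).
Proof.
(* By [durationE] there are 48 * 2 ^ trunc_log 2 f - 4 <= 48 f rounds. The awake rounds number at
   most 6 (trunc_log 2 f + 3) + 2 <= 26 trunc_log 2 f, as the logarithm is at least 1 for f >= 2. *)
exists 48, 2 => n f V _ lt_f; exists (compile (@agreement n f V)).
have mainR i v : is_round (@agreement n f V i v) by [].
split=> [x B Bf|f_ge2].
  have [u [uE [w uw] uval]] := agreement_correct lt_f x Bf.
  have out i : honest B i -> outputs x B i (u i).
    move=> hi; exists (duration (depth f) + 2).
    by rewrite (config_residual mainR) uE.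
  split=> [i v hi|v xv j hj|i hi]; last by exists (u i); apply: out.
  - move=> /(outputs_residual mainR (uE i hi)) -> j hj.
    by rewrite uw // -(uw j hj); apply: out.
  - by rewrite -(uval v xv j hj); apply: out.
have f_gt0 : 0 < f by lia.
have le_f := trunc_logP (isT : 1 < 2) f_gt0.
have log_gt0 : 0 < trunc_log 2 f by rewrite trunc_log_gt0.
split=> [x B Bf i hi|x B Bf i hi T].
  have [u [uE _ _]] := agreement_correct lt_f x Bf; exists (u i).
  have le_T : duration (depth f) + 2 <= 48 * f.
    by have := durationE (depth f); rewrite /depth expnD; lia.
  rewrite -(subnKC le_T); set s := _ - _.
  elim: s => [|s IH]; first by rewrite addn0 (config_residual mainR) uE.
  by rewrite addnS /= /next_status IH.
have := awake_rounds_residual mainR B T (agreement_rounds f i (x i)).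
by move=> /leq_trans; apply; rewrite /depth; lia.
Qed.
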